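(* Let $K$ be a pre-$\operatorname{d}$-valued field of $H$-type. If $K$ is $\lambda$-free, then its differential-valued hull $\operatorname{dv}(K)$ is $\lambda$-free.
   Context: $\operatorname{dv}(K)$ is a $\operatorname{d}$-valued extension of $K$ of $H$-type such that any embedding of $K$ into a $\operatorname{d}$-valued field of $H$-type extends uniquely to $\operatorname{dv}(K)$. An ungrounded $H$-asymptotic field $K$ with value group $\Gamma\neq\{0\}$ is $\lambda$-free if for every $s\in K$ there is $g\succ1$ in $K$ with $s-(g^\dagger)^\dagger\succcurlyeq g^\dagger$, where $a^\dagger=a'/a$. *)

(* Defs.v *)
(* Valued differential fields, following
   Aschenbrenner--van den Dries--van der Hoeven (ADH), with the valuation
   given as a dominance relation  f ≼ g  (ADH 3.1). *)
From HB Require Import structures.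
From mathcomp Require Import all_boot all_order all_algebra.
Set Implicit Arguments. Unset Strict Implicit. Unset Printing Implicit Defensive.
Import Order.TTheory GRing.Theory Num.Theory.
Local Open Scope ring_scope.

Definition is_derivation (F : fieldType) (d : F -> F) : Prop :=
  (forall x y, d (x + y) = d x + d y) /\ (forall x y, d (x * y) = d x * y + x * d y).

(* dominance relation (ADH 3.1): dom f g  means  f ≼ g  (i.e. v f >= v g) *)
Definition is_dominance (F : fieldType) (dom : F -> F -> Prop) : Prop :=
  (dom 0 1 /\ ~ dom 1 0) /\
  (forall f, dom f f) /\
  (forall f g h, dom f g -> dom g h -> dom f h) /\
  (forall f g, dom f g \/ dom g f) /\
  (forall f g h, dom f g -> dom (f * h) (g * h)) /\
  (forall f g h, dom f h -> dom g h -> dom (f - g) h).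

Record VDF := {
  vcar :> fieldType;
  vder : vcar -> vcar;
  vdom : vcar -> vcar -> Prop;
  vder_ok : is_derivation vder;
  vdom_ok : is_dominance vdom }.

Section VDFdefs.
Variable K : VDF.

Definition vprec (f g : K) : Prop := vdom f g /\ ~ vdom g f.
Definition vasym (f g : K) : Prop := vdom f g /\ vdom g f.
Definition dagger (f : K) : K := vder f / f.

Definition asymptotic : Prop :=
  forall f g : K, f != 0 -> g != 0 -> vprec f 1 -> vprec g 1 ->
    (vprec f g <-> vprec (vder f) (vder g)).

Definition H_asymptotic : Prop :=
  asymptotic /\
  forall f g : K, f != 0 -> vprec f g -> vprec g 1 -> vdom (dagger g) (dagger f).

Definition pre_d_valued : Prop :=
  forall f g : K, vdom f 1 -> g != 0 -> vprec g 1 -> vprec (vder f) (dagger g).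

Definition d_valued : Prop :=
  pre_d_valued /\
  forall f : K, vdom f 1 -> exists c : K, vder c = 0 /\ vprec (f - c) 1.

Definition nontrivial_valuation : Prop := exists g : K, g != 0 /\ vprec g 1.

(* ungrounded: Ψ = { v(g†) : g ∈ K^×, v g ≠ 0 } has no largest element *)
Definition ungrounded : Prop :=
  forall g : K, g != 0 -> ~ vasym g 1 ->
    exists h : K, h != 0 /\ ~ vasym h 1 /\ vprec (dagger h) (dagger g).

Definition lambda_free : Prop :=
  [/\ H_asymptotic, ungrounded, nontrivial_valuation &
      (forall s : K, exists g : K, vprec 1 g /\ vdom (dagger g) (s - dagger (dagger g)))].

End VDFdefs.

Definition vdf_embedding (K L : VDF) (i : K -> L) : Prop :=
  injective i /\
  i 1 = 1 /\
  (forall x y, i (x + y) = i x + i y) /\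
  (forall x y, i (x * y) = i x * i y) /\
  (forall x, i (vder x) = vder (i x)) /\
  (forall x y, vdom x y <-> vdom (i x) (i y)).

Definition is_dv_hull (K L : VDF) (e : K -> L) : Prop :=
  [/\ d_valued L, H_asymptotic L, vdf_embedding e &
      (forall (M : VDF) (i : K -> M), d_valued M -> H_asymptotic M -> vdf_embedding i ->
        (exists j : L -> M, vdf_embedding j /\ forall x, j (e x) = i x) /\
        (forall j1 j2 : L -> M, vdf_embedding j1 -> vdf_embedding j2 ->
           (forall x, j1 (e x) = i x) -> (forall x, j2 (e x) = i x) ->
           forall y, j1 y = j2 y))].

(* Main.v *)
(** Identify K with its image A in L. The fraction field of the A-span of all
    constants of L infinitely close to an element of A is d-valued, hence
    contains a copy of the hull, and uniqueness of embeddings out of L forces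
    it to be all of L.

    The heart of the matter is a uniform approximation: for finitely many such
    constants there is a single d ≺ 1 in A such that every A-linear combination
    w of them satisfies w - a ≼ d w for some a in A. This is proved by induction
    on the number of constants, since normalizing a coefficient to 1 makes the
    derivative of w a combination of fewer constants; lambda-freeness of A
    provides the integration needed to pass from w' back to w. Thus every
    approximation in A of an element s of L can be improved by a fixed factor
    d ≺ 1, which is impossible if s witnesses the failure of lambda-freeness. *)
Require Import Defs.
From HB Require Import structures.
From mathcomp Require Import all_boot all_order all_algebra ring boolp.
Set Implicit Arguments. Unset Strict Implicit. Unset Printing Implicit Defensive.
Import GRing.Theory.
Local Open Scope ring_scope.

Local Notation "f ≼ g" := (vdom f g) (at level 70).
Local Notation "f ≺ g" := (vprec f g) (at level 70).
Local Notation "f ≍ g" := (vasym f g) (at level 70).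

(** * Elementary calculus of dominance, derivations and logarithmic derivatives *)

Section Dominance.
Variable K : VDF.
Implicit Types f g h k : K.

Lemma dom_refl f : f ≼ f.
Proof. by case: (vdom_ok K) => _ [+ _]; apply. Qed.

Lemma dom_trans g f h : f ≼ g -> g ≼ h -> f ≼ h.
Proof. by case: (vdom_ok K) => _ [_ [H _]]; apply: H. Qed.

Lemma dom_total f g : f ≼ g \/ g ≼ f.
Proof. by case: (vdom_ok K) => _ [_ [_ [H _]]]; apply: H. Qed.

Lemma domMr h f g : f ≼ g -> f * h ≼ g * h.
Proof. by case: (vdom_ok K) => _ [_ [_ [_ [H _]]]]; apply: H. Qed.

Lemma domMl h f g : f ≼ g -> h * f ≼ h * g.
Proof. by rewrite ![h * _]mulrC; apply: domMr. Qed.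

Lemma domB f g h : f ≼ h -> g ≼ h -> f - g ≼ h.
Proof. by case: (vdom_ok K) => _ [_ [_ [_ [_ H]]]]; apply: H. Qed.

Lemma dom0 f : 0 ≼ f.
Proof. by have [[d01 _] _] := vdom_ok K; have := domMr f d01; rewrite mul0r mul1r. Qed.

Lemma dom_le0 f : f ≼ 0 -> f = 0.
Proof.
move=> h; apply/eqP; apply: contraT => f0; have [[_ nd10] _] := vdom_ok K; case: nd10.
by have := domMr f^-1 h; rewrite mul0r mulfV.
Qed.

Lemma domN f g : f ≼ g -> - f ≼ g.
Proof. by rewrite -(sub0r f); apply: domB; apply: dom0. Qed.

Lemma domD f g h : f ≼ h -> g ≼ h -> f + g ≼ h.
Proof. by move=> fh gh; rewrite -[g]opprK; apply: domB => //; apply: domN. Qed.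

Lemma domM f g h k : f ≼ g -> h ≼ k -> f * h ≼ g * k.
Proof. by move=> /(domMr h) fg /(domMl g); apply: dom_trans. Qed.

Lemma dom_sum (I : Type) (r : seq I) (F : I -> K) g :
  (forall i, F i ≼ g) -> \sum_(i <- r) F i ≼ g.
Proof.
move=> Fg; elim/big_ind: _ => // [|x y]; [exact: dom0 | exact: domD].
Qed.

Lemma precE f g : f ≺ g <-> ~ g ≼ f.
Proof. by split=> [[]//|ngf]; split=> //; case: (dom_total f g). Qed.

Lemma not_prec f g : ~ f ≺ g -> g ≼ f.
Proof. by move=> nfg; case: (pselect (g ≼ f)) => // /precE. Qed.

Lemma precW f g : f ≺ g -> f ≼ g. Proof. by case. Qed.

Lemma prec_irr f : ~ f ≺ f. Proof. by case. Qed.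

Lemma prec_dom_trans g f h : f ≺ g -> g ≼ h -> f ≺ h.
Proof.
by move=> /precE fg gh; apply/precE => hf; apply: fg; apply: dom_trans hf.
Qed.

Lemma dom_prec_trans g f h : f ≼ g -> g ≺ h -> f ≺ h.
Proof.
by move=> fg /precE gh; apply/precE => hf; apply: gh; apply: dom_trans fg.
Qed.

Lemma prec_neq0 f g : f ≺ g -> g != 0.
Proof. by move=> /precE fg; apply/eqP => g0; apply: fg; rewrite g0; apply: dom0. Qed.

Lemma prec0 g : g != 0 -> 0 ≺ g.
Proof. by move=> g0; apply/precE => /dom_le0 /eqP; rewrite (negPf g0). Qed.

Lemma domMr_inv h f g : h != 0 -> f * h ≼ g * h -> f ≼ g.
Proof. by move=> h0 /(domMr h^-1); rewrite !mulfK. Qed.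

Lemma precMr h f g : h != 0 -> f ≺ g -> f * h ≺ g * h.
Proof. by move=> h0 /precE fg; apply/precE => /(domMr_inv h0). Qed.

Lemma precMl h f g : h != 0 -> f ≺ g -> h * f ≺ h * g.
Proof. by rewrite ![h * _]mulrC; apply: precMr. Qed.

Lemma precMl_inv h f g : h * f ≺ h * g -> f ≺ g.
Proof. by move=> /precE fg; apply/precE => /(domMl h). Qed.

Lemma precD f g h : f ≺ h -> g ≺ h -> f + g ≺ h.
Proof.
move=> fh gh; case: (dom_total f g) => fg.
  by apply: dom_prec_trans gh; apply: domD => //; apply: dom_refl.
by apply: dom_prec_trans fh; apply: domD => //; apply: dom_refl.
Qed.

Lemma precN f g : f ≺ g -> - f ≺ g.
Proof. by move=> fg; apply: dom_prec_trans fg; apply/domN/dom_refl. Qed.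

Lemma domNr f g : f ≼ g -> f ≼ - g.
Proof. by move=> fg; apply: dom_trans fg _; rewrite -{1}[g]opprK; apply/domN/dom_refl. Qed.

Lemma precNr f g : f ≺ g -> f ≺ - g.
Proof. by move=> fg; apply: prec_dom_trans fg _; apply/domNr/dom_refl. Qed.

(** The hypothesis is asymptotic equivalence. Were [f ≺ g], then [- g = (f - g) - f] would be
    [≺ g]. *)
Lemma precB_asym f g : f - g ≺ g -> f ≍ g.
Proof.
move=> fg; split; first by rewrite -(subrK g f); apply: domD (precW fg) (dom_refl _).
apply: not_prec => lt_fg.
have /precE[] : f - g - f ≺ g by apply: precD fg (precN lt_fg).
by rewrite addrAC subrr sub0r; apply/domNr/dom_refl.
Qed.

Lemma precV1 f : 1 ≺ f -> f^-1 ≺ 1.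
Proof.
move=> f1; have f0 := prec_neq0 f1; have fi0 : f^-1 != 0 by rewrite invr_eq0.
by have := precMr fi0 f1; rewrite mul1r mulfV.
Qed.

Lemma prec_div1 f g : f ≺ g -> f / g ≺ 1.
Proof.
move=> fg; have g0 := prec_neq0 fg; have gi0 : g^-1 != 0 by rewrite invr_eq0.
by have := precMr gi0 fg; rewrite mulfV.
Qed.

Lemma dom_div1 f g : g != 0 -> f ≼ g -> f / g ≼ 1.
Proof. by move=> g0 /(domMr g^-1); rewrite mulfV. Qed.

Lemma domV f g : f != 0 -> f ≼ g -> g^-1 ≼ f^-1.
Proof.
move=> f0 fg; have g0 : g != 0.
  by apply/eqP => g0; move: fg f0; rewrite g0 => /dom_le0 ->; rewrite eqxx.
have := domMr (f^-1 * g^-1) fg.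
by rewrite mulrA mulfV // mul1r mulrCA mulfV // mulr1.
Qed.

Lemma dom_max n (f : 'I_n.+1 -> K) : exists j, forall i, f i ≼ f j.
Proof.
elim: n => [|n IHn] in f *.
  by exists ord0 => i; rewrite ord1; apply: dom_refl.
have [j jmax] := IHn (fun i => f (lift ord0 i)).
case: (dom_total (f ord0) (f (lift ord0 j))) => h.
  by exists (lift ord0 j) => i; case: (unliftP ord0 i) => [k|] ->.
exists ord0 => i; case: (unliftP ord0 i) => [k|] ->; last exact: dom_refl.
exact: dom_trans (jmax k) h.
Qed.

Lemma prec_or_asym f : [\/ f ≺ 1, f ≍ 1 | 1 ≺ f].
Proof.
case: (pselect (1 ≼ f)) => [f1|/precE]; last by constructor 1.
case: (pselect (f ≼ 1)) => [f1'|/precE]; last by constructor 3.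
by constructor 2.
Qed.

Lemma derD f g : vder (f + g) = vder f + vder g.
Proof. by case: (vder_ok K). Qed.

Lemma derM f g : vder (f * g) = vder f * g + f * vder g.
Proof. by case: (vder_ok K). Qed.

Lemma der0 : vder (0 : K) = 0.
Proof. by apply: (addIr (vder 0)); rewrite -derD !add0r. Qed.

Lemma der1 : vder (1 : K) = 0.
Proof. by apply: (addIr (vder 1)); rewrite -[in RHS](mulr1 1) derM mulr1 mul1r add0r. Qed.

Lemma derN f : vder (- f) = - vder f.
Proof. by apply/eqP; rewrite -addr_eq0 -derD addNr der0. Qed.

Lemma derB f g : vder (f - g) = vder f - vder g.
Proof. by rewrite derD derN. Qed.

Lemma derV f : vder f^-1 = - vder f / f ^+ 2.
Proof.
have [->|f0] := eqVneq f 0; first by rewrite invr0 der0 oppr0 mul0r.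
apply: (mulfI f0); apply: (addrI (vder f * f^-1)).
by rewrite -derM mulfV // der1; field.
Qed.

Lemma der_sum (I : Type) (r : seq I) (F : I -> K) :
  vder (\sum_(i <- r) F i) = \sum_(i <- r) vder (F i).
Proof. exact: (big_morph (@vder K) derD der0). Qed.

Lemma der_dagger f : f != 0 -> vder f = f * dagger f.
Proof. by move=> f0; rewrite /dagger; field. Qed.

Lemma daggerM f g : f != 0 -> g != 0 -> dagger (f * g) = dagger f + dagger g.
Proof. by move=> f0 g0; rewrite /dagger derM; field; apply/andP. Qed.

Lemma daggerV f : f != 0 -> dagger f^-1 = - dagger f.
Proof. by move=> f0; rewrite /dagger derV invrK; field. Qed.

Lemma dagger_div f g : f != 0 -> g != 0 -> dagger (f / g) = dagger f - dagger g.
Proof. by move=> f0 g0; rewrite daggerM ?invr_eq0 // daggerV. Qed.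

End Dominance.

(** * Comparing derivatives in pre-d-valued fields of H-type *)

Section PreDValued.
Variable L : VDF.
Hypotheses (Lpd : pre_d_valued L) (LH : H_asymptotic L).
Implicit Types f g h : L.

(** For [1 ≺ g] the axiom is applied to the inverse, whose logarithmic derivative is
    [- dagger g]. *)
Lemma der_prec_dagger f g : f ≼ 1 -> g != 0 -> ~ g ≍ 1 -> vder f ≺ dagger g.
Proof.
move=> f1 g0 ng; case: (prec_or_asym g) => // g1; first exact: Lpd.
rewrite -[dagger g]opprK -daggerV //; apply/precNr/Lpd => //.
  by rewrite invr_eq0.
exact: precV1.
Qed.

Lemma prec1_nasym f : f ≺ 1 -> ~ f ≍ 1.
Proof. by case=> _ n1 []. Qed.

Lemma dagger_neq0 g : g != 0 -> ~ g ≍ 1 -> dagger g != 0.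
Proof. by move=> g0 /(der_prec_dagger (dom0 1) g0); apply: prec_neq0. Qed.

Lemma der_neq0 g : g != 0 -> ~ g ≍ 1 -> vder g != 0.
Proof. by move=> g0 ng; rewrite der_dagger // mulf_neq0 // dagger_neq0. Qed.

Lemma der_prec f g : f ≺ g -> g ≺ 1 -> vder f ≺ vder g.
Proof.
move=> fg g1; have g0 := prec_neq0 fg.
have [->|f0] := eqVneq f 0.
  by rewrite der0; apply/prec0/der_neq0 => //; apply: prec1_nasym.
by apply/(LH.1 f g) => //; apply: dom_prec_trans (precW fg) g1.
Qed.

Lemma der_dom f g : g != 0 -> f ≺ 1 -> g ≺ 1 -> vder f ≼ vder g -> f ≼ g.
Proof.
by move=> g0 f1 g1 fg; apply: not_prec => /der_prec/(_ f1)/precE[].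
Qed.

(** The difference is the logarithmic derivative of the unit [f / g]; as [g / f ≼ 1], it is
    [≼ vder (f / g)], which is [≺ dagger g]. *)
Lemma dagger_asym f g : f != 0 -> f ≍ g -> ~ g ≍ 1 -> dagger f - dagger g ≺ dagger g.
Proof.
move=> f0 [fg gf] ng; have g0 : g != 0.
  by apply/eqP => g0; move: fg f0; rewrite g0 => /dom_le0 ->; rewrite eqxx.
have fg0 : f / g != 0 by rewrite mulf_neq0 // invr_eq0.
have fg1 : f / g ≼ 1 by apply: dom_div1.
have gf1 : g / f ≼ 1 by apply: dom_div1.
rewrite -dagger_div // /dagger.
apply: dom_prec_trans (der_prec_dagger fg1 g0 ng).
by have := domMl (vder (f / g)) gf1; rewrite mulr1 invf_div.
Qed.

(** Extends the H-type condition from [f ≺ g] to [f ≼ g]: for [f ≍ g] the logarithmic derivatives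
    are asymptotic. *)
Lemma dagger_dom f g : f != 0 -> f ≼ g -> g ≺ 1 -> dagger g ≼ dagger f.
Proof.
move=> f0 fg g1; case: (pselect (g ≼ f)) => [gf|/precE fg']; last exact: LH.2.
by have [] := precB_asym (dagger_asym f0 (conj fg gf) (prec1_nasym g1)).
Qed.

End PreDValued.

(** * Integration inside a lambda-free differential subfield [A] of [L] *)

Section LambdaFreeSubfield.
Variables (L : VDF) (A : divringClosed L).
Hypotheses (Lpd : pre_d_valued L) (LH : H_asymptotic L).
Hypothesis Ader : forall x, x \in A -> vder x \in A.
Hypothesis Anontriv : exists2 g, g \in A & g != 0 /\ g ≺ 1.
Hypothesis Aungr : forall g, g \in A -> g != 0 -> ~ g ≍ 1 ->
  exists2 h, h \in A & [/\ h != 0, ~ h ≍ 1 & dagger h ≺ dagger g].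
Hypothesis Alambda : forall s, s \in A ->
  exists2 g, g \in A & 1 ≺ g /\ dagger g ≼ s - dagger (dagger g).

Implicit Types a b c d e g h p q s t u w z : L.

Lemma dagger_in x : x \in A -> dagger x \in A.
Proof. by move=> xA; rewrite rpred_div ?Ader. Qed.

Lemma ungrounded_small z : z \in A -> z != 0 -> z ≺ 1 ->
  exists2 h, h \in A & [/\ h != 0, h ≺ 1 & dagger h ≺ dagger z].
Proof.
move=> zA z0 z1; have [h hA [h0 nh hz]] := Aungr zA z0 (prec1_nasym z1).
case: (prec_or_asym h) => // h1; first by exists h.
exists h^-1; first by rewrite rpredV.
split; [by rewrite invr_eq0 | exact: precV1 |].
by rewrite daggerV //; apply: precN.
Qed.

(** The larger of [e] and the [h] given by [ungrounded_small] works: by [dagger_dom], passing to a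
    larger infinitesimal does not increase the logarithmic derivative. *)
Lemma ungrounded_between e z : e \in A -> e != 0 -> e ≺ 1 ->
    z \in A -> z != 0 -> z ≺ 1 ->
  exists2 d, d \in A & [/\ d != 0, e ≼ d, d ≺ 1 & dagger d ≺ dagger z].
Proof.
move=> eA e0 e1 zA z0 z1; have [h hA [h0 h1 hz]] := ungrounded_small zA z0 z1.
case: (dom_total e h) => eh; first by exists h.
exists e => //; split=> //; first exact: dom_refl.
exact: dom_prec_trans (dagger_dom Lpd LH h0 eh e1) hz.
Qed.

(* Applying lambda-freeness to s = u† gives g with (u/g†)† ≽ g†; the element
   q (g†/q†), where q = u/g†, has the required derivative because g†/q† ≼ 1
   makes its logarithmic derivative small compared to q†. *)
Lemma asymptotic_integration u : u \in A -> u != 0 ->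
  exists2 b, b \in A & [/\ b != 0, ~ b ≍ 1 & vder b ≍ u].
Proof.
move=> uA u0; have [g gA [g1 hg]] := Alambda (dagger_in uA).
have ng : ~ g ≍ 1 by case=> /(prec_dom_trans g1)/prec_irr.
have g0 : g != 0 by apply: prec_neq0 g1.
have dg0 : dagger g != 0 by apply: dagger_neq0.
rewrite -dagger_div // in hg; set q := u / dagger g in hg.
have qA : q \in A by rewrite rpred_div ?dagger_in.
have q0 : q != 0 by rewrite mulf_neq0 // invr_eq0.
have dq0 : dagger q != 0.
  by apply/eqP => e; move: hg; rewrite e => /dom_le0/eqP; rewrite (negPf dg0).
set m := dagger g / dagger q.
have m0 : m != 0 by rewrite mulf_neq0 // invr_eq0.
have m1 : m ≼ 1 by apply: dom_div1.
have mq : dagger m ≺ dagger q.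
  apply: (@precMl_inv _ m); rewrite -der_dagger // [m * _]divfK //.
  exact: der_prec_dagger.
have qm0 : q * m != 0 by rewrite mulf_neq0.
have dqm : dagger (q * m) ≍ dagger q.
  by apply: precB_asym; rewrite daggerM // addrAC subrr add0r.
exists (q * m); first by apply: rpredM => //; apply: rpred_div; apply: dagger_in.
split=> //; last first.
  have uE : u = q * m * dagger q.
    by rewrite -mulrA [m * _]divfK // /q divfK.
  rewrite der_dagger // uE.
  by case: dqm => ? ?; split; apply: domMl.
move=> [qm1 qm1'].
have /precE[] := der_prec_dagger Lpd qm1 g0 ng.
apply: dom_trans hg _; apply: dom_trans dqm.2 _.
by have := domMr (dagger (q * m)) qm1'; rewrite mul1r -der_dagger.
Qed.

(** An asymptotic integral [b] of [u] must be [≺ 1]: if [1 ≺ b], then [dagger b ≼ vder b ≍ vder w],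
    against [vder w ≺ dagger b]. Among infinitesimals, asymptotic derivatives force [b ≍ w]. *)
Lemma small_integral w u : w ≺ 1 -> u \in A -> u != 0 -> vder w ≍ u ->
  exists2 b, b \in A & [/\ b != 0, b ≍ w & vder b ≍ u].
Proof.
move=> w1 uA u0 [wu uw]; have [b bA [b0 nb [bu ub]]] := asymptotic_integration uA u0.
exists b => //; split=> //.
have w0 : w != 0.
  by apply/eqP => w0; move: uw u0; rewrite w0 der0 => /dom_le0 ->; rewrite eqxx.
have b1 : b ≺ 1.
  case: (prec_or_asym b) => // b1.
  have /precE[] := der_prec_dagger Lpd (precW w1) b0 nb.
  apply: (dom_trans (g := vder b)); last exact: dom_trans uw.
  by have := domMr (dagger b) (precW b1); rewrite mul1r -der_dagger.
by split; apply: (der_dom Lpd LH) => //; [apply: dom_trans uw | apply: dom_trans ub].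
Qed.

(** * Approximation in [A] with relative error [d] *)

Definition approx d w := exists2 a, a \in A & w - a ≼ d * w.

Lemma approx_mono d d' w : d ≼ d' -> approx d w -> approx d' w.
Proof. by move=> dd' [a aA aw]; exists a => //; apply: dom_trans aw _; apply: domMr. Qed.

Definition small d := [/\ d \in A, d != 0 & d ≺ 1].

Lemma small_max d d' : small d -> small d' ->
  exists2 m, small m & d ≼ m /\ d' ≼ m.
Proof.
move=> sd sd'; case: (dom_total d d') => h; [exists d' | exists d] => //;
by split=> //; apply: dom_refl.
Qed.

(** By monotonicity the largest of the finitely many witnesses serves for all; for the empty family
    nontriviality of the valuation on [A] supplies one. *)
Lemma small_uniform n (P : 'I_n -> L -> Prop) :
    (forall i d d', d ≼ d' -> P i d -> P i d') ->
    (forall i, exists2 d, small d & P i d) ->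
  exists2 d, small d & forall i, P i d.
Proof.
elim: n => [|n IHn] in P * => Pmono Pex.
  by have [g gA [g0 g1]] := Anontriv; exists g => // -[].
have [d sd dP] := IHn (fun i => P (lift ord0 i))
  (fun i => Pmono (lift ord0 i)) (fun i => Pex (lift ord0 i)).
have [d' sd' d'P] := Pex ord0; have [m sm [dm d'm]] := small_max sd sd'.
exists m => // i; case: (unliftP ord0 i) => [j|] ->; first exact: Pmono dm _.
exact: Pmono d'm _.
Qed.

(** If [u] in [A] approximates [vder w], an asymptotic integral [b ≍ w] of [u], suitably corrected,
    approximates [w]. The essential point is that [d] depends on [z] and [d0] only, not on [w]. *)
Lemma approx_of_der z d0 : small z -> small d0 ->
  exists2 d, small d & d0 ≼ d /\
    forall w, w ≺ z -> approx d0 (vder w) -> approx d w.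
Proof.
move=> [zA z0 z1] [d0A d00 d01].
have [h hA [h0 h1 hz]] := ungrounded_small zA z0 z1.
have dz0 : dagger z != 0 by apply/dagger_neq0/prec1_nasym.
have dh0 : dagger h != 0 by apply/dagger_neq0/prec1_nasym.
(* Every [g ≼ 1] satisfies [vder g ≺ dagger h = k * dagger z], which will control the derivative of
   the correction factor. *)
set k := dagger h / dagger z.
have sk : small k.
  split; first by rewrite rpred_div ?dagger_in.
    by rewrite mulf_neq0 // invr_eq0.
  exact: prec_div1.
have [m [mA m0 m1] [d0m km]] := small_max (And3 d0A d00 d01) sk.
(* [d] bounds [d0] and [k], while [dagger d ≺ dagger z] makes [vder (d * w)] comparable to
   [d * vder w] for nonzero [w ≺ z]. *)
have [d dA [dn0 md d1 dz]] := ungrounded_between mA m0 m1 zA z0 z1.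
have d0d := dom_trans d0m md; have kd := dom_trans km md.
exists d; first by []; split=> // w wz [u uA uw].
have [->|w0] := eqVneq w 0.
  by exists 0; rewrite ?rpred0 // subr0 mulr0; apply: dom0.
have w1 : w ≺ 1 by apply: prec_dom_trans wz (precW z1).
have dw0 : vder w != 0 by apply: der_neq0 => //; apply: prec1_nasym.
have [uw1 uw2] : u ≍ vder w.
  apply: precB_asym; rewrite -opprB; apply/precN.
  apply: dom_prec_trans uw _; rewrite -[X in _ ≺ X]mul1r; exact: precMr.
have u0 : u != 0.
  by apply/eqP => e; move: uw2 dw0; rewrite e => /dom_le0 ->; rewrite eqxx.
have [b bA [b0 [bw wb] [bu ub]]] := small_integral w1 uA u0 (conj uw2 uw1).
have db0 : vder b != 0.
  by apply/eqP => e; move: ub u0; rewrite e => /dom_le0 ->; rewrite eqxx.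
(* Since [vder b] is only [≍ u], the factor [g] is inserted to have [g * vder b = u], at the cost of
   the term [vder g * b] in the derivative of [g * b]. *)
set g := u / vder b.
have g1 : g ≼ 1 by apply: dom_div1.
have gA : g \in A by rewrite rpred_div ?Ader.
have b1 : b ≺ 1 by apply: dom_prec_trans bw w1.
exists (g * b); first by rewrite rpredM.
(* Otherwise [d * w ≺ w - g * b]; differentiating both sides will contradict [dr]. *)
apply: not_prec => dw_lt.
have dr1 : w - g * b ≺ 1.
  apply: precD => //; apply/precN; apply: dom_prec_trans b1.
  by have := domMr b g1; rewrite mul1r.
have dr : vder (w - g * b) ≼ d * vder w.
  have -> : vder (w - g * b) = (vder w - u) - vder g * b.
    have -> : u = g * vder b by rewrite /g divfK.
    by rewrite derB derM; ring.
  apply: domB; first by apply: dom_trans uw _; apply: domMr.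
  (* The extra term is [≼ k * (dagger z * b)], where [k ≼ d] and
     [dagger z * b ≼ vder b ≼ vder w]. *)
  have gh : vder g ≼ dagger h.
    exact/precW/(der_prec_dagger Lpd g1 h0 (prec1_nasym h1)).
  apply: (dom_trans (domMr b gh)).
  have -> : dagger h = k * dagger z by rewrite /k divfK.
  rewrite -mulrA; apply: domM => //.
  have zb : dagger z ≼ dagger b.
    by apply: (dagger_dom Lpd LH b0 _ z1); apply: dom_trans bw (precW wz).
  apply: dom_trans (domMr b zb) _; rewrite mulrC -der_dagger //.
  exact: dom_trans bu uw1.
have := der_prec Lpd LH dw_lt dr1.
move=> /(prec_dom_trans)/(_ dr)/precE[].
(* In [vder (d * w) = d * w * (dagger d + dagger w)] the second summand dominates, because
   [dagger d ≺ dagger z ≼ dagger w]. *)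
rewrite (der_dagger (mulf_neq0 dn0 w0)) daggerM // (der_dagger w0) mulrA.
have zw : dagger z ≼ dagger w := dagger_dom Lpd LH w0 (precW wz) z1.
apply/domMl/(precB_asym _).2; rewrite addrK; exact: prec_dom_trans dz zw.
Qed.

(** * Constants infinitely close to [A] and uniform approximation of their combinations *)

Definition near_const c := vder c = 0 /\ exists2 a, a \in A & c - a ≺ 1.

Lemma const_dom1 c : vder c = 0 -> c ≼ 1.
Proof.
move=> dc; case: (prec_or_asym c) => [/precW|[]|c1] //.
have := der_neq0 Lpd (prec_neq0 c1); rewrite dc eqxx.
by move=> H; have : false by apply: H => -[/(prec_dom_trans c1)/prec_irr].
Qed.

(** The error [c - a] need not lie in [A], but its derivative [- vder a] does; integrating this in
    [A] gives an element asymptotic to the error. *)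
Lemma near_const_approx c : near_const c ->
  exists2 e : L, small e & exists2 a, a \in A & c - a ≼ e.
Proof.
move=> [dc [a aA ca]]; have [ca0|ca0] := eqVneq (c - a) 0.
  have [g gA [g0 g1]] := Anontriv; exists g => //; exists a => //.
  by rewrite ca0; apply: dom0.
have dca : vder (c - a) != 0 by apply: der_neq0 => //; apply: prec1_nasym.
have uA : vder (c - a) \in A by rewrite derB dc sub0r rpredN Ader.
have [b bA [b0 [bca cab] _]] :=
  small_integral ca uA dca (conj (dom_refl _) (dom_refl _)).
exists b; last by exists a.
by split=> //; apply: dom_prec_trans bca ca.
Qed.

(* Normalize the largest coefficient to be 1. Unless w is very small, fixed
   approximations of the constants c i approximate w; otherwise w is recovered
   by integration from its derivative, a combination of fewer constants. *)
Lemma approx_combination n (c : 'I_n -> L) : (forall i, near_const (c i)) ->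
  exists2 d, small d &
    forall f, (forall i, f i \in A) -> approx d (\sum_i f i * c i).
Proof.
elim: n => [|n IHn] in c *.
  move=> _; have [g gA [g0 g1]] := Anontriv; exists g => // f _.
  by exists 0; rewrite ?rpred0 // big_ord0 subr0 mulr0; apply: dom0.
move=> cn.
have [d0 sd0 d0P] : exists2 d, small d & forall j f, (forall i, f i \in A) ->
    approx d (\sum_i f i * c (lift j i)).
  apply: small_uniform => [j d d' dd' H f fA|j].
    by apply: approx_mono dd' _; apply: H.
  exact: IHn.
have [e se eP] : exists2 e : L, small e & forall i, exists2 a, a \in A & c i - a ≼ e.
  apply: small_uniform => [i d d' dd' [a aA ca]|i].
    by exists a => //; apply: dom_trans dd'.
  exact: near_const_approx.
have [eA e0 e1] := se.
have [z zA [z0 ez z1 dz]] := ungrounded_between eA e0 e1 eA e0 e1.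
(* The inequality [dagger z ≺ dagger e] forces strictness here, so that [e / z] is small. *)
have {ez dz} ez : e ≺ z.
  by apply/precE => ze; case/precE: dz; apply: dagger_dom.
have sez : small (e / z).
  split; first by rewrite rpred_div.
    by rewrite mulf_neq0 // invr_eq0.
  exact: prec_div1.
have [d1 sd1 [_ d1P]] := approx_of_der (And3 zA z0 z1) sd0.
have [d sd [d1d ed]] := small_max sd1 sez.
exists d => // f fA; have [j fj] := dom_max f.
have [fj0|fj0] := eqVneq (f j) 0.
  exists 0; first exact: rpred0.
  rewrite big1 ?subr0 ?mulr0; first exact: dom0.
  by move=> i _; have := fj i; rewrite fj0 => /dom_le0 ->; rewrite mul0r.
pose F i := f i / f j; set w := \sum_i F i * c i.
have FA i : F i \in A by rewrite rpred_div.
have F1 i : F i ≼ 1 by apply: dom_div1.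
have -> : \sum_i f i * c i = f j * w.
  rewrite mulr_sumr; apply: eq_bigr => i _.
  by rewrite /F mulrA mulrCA mulfV // mulr1.
(* Relative error is unaffected by the factor [f j] from [A]. *)
suff [a aA aw] : approx d w.
  exists (f j * a); first by rewrite rpredM.
  by rewrite -mulrBr mulrCA; apply: domMl.
case: (pselect (z ≼ w)) => [zw|/precE wz].
  have [a aA ca] := fin_all_exists2 eP.
  exists (\sum_i F i * a i).
    by apply: rpred_sum => i _; apply: rpredM.
  rewrite -sumrB; apply: (dom_trans (g := e)).
    apply: dom_sum => i; by rewrite -mulrBr -[e]mul1r; apply: domM.
  by rewrite -[e](divfK z0); apply: domM.
apply: approx_mono d1d _; apply: d1P => //.
(* The term at [j] disappears because [F j = 1] and [c j] is constant. *)
have -> : vder w = \sum_i vder (F (lift j i)) * c (lift j i).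
  rewrite der_sum (bigD1_ord j) //= {1}/F mulfV // mul1r (cn j).1 add0r.
  by apply: eq_bigr => i _; rewrite derM (cn _).1 mulr0 addr0.
by apply: d0P => i; apply: Ader.
Qed.

(** * The [A]-span of the near constants, its fraction field, and approximation of fractions *)

Definition combination w := exists r : seq (L * L),
  (forall x, x \in r -> x.1 \in A /\ near_const x.2) /\
  w = \sum_(x <- r) x.1 * x.2.

Definition fraction (x : L) := exists p q,
  [/\ combination p, combination q, q != 0 & x = p / q].

Lemma combination_in a c : a \in A -> near_const c -> combination (a * c).
Proof.
move=> aA cn; exists [:: (a, c)]; split; last by rewrite big_seq1.
by move=> x; rewrite inE => /eqP ->.
Qed.

Lemma near_const1 : near_const 1.
Proof.
split; first exact: der1.
by exists 1; rewrite ?rpred1 // subrr; apply/prec0/oner_neq0.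
Qed.

(** This makes the [A]-span of the near constants a ring. *)
Lemma near_constM c e : near_const c -> near_const e -> near_const (c * e).
Proof.
move=> [dc [a aA ca]] [de [b bA eb]].
split; first by rewrite derM dc de mul0r mulr0 addr0.
exists (a * b); first by rewrite rpredM.
have -> : c * e - a * b = (c - a) * e + a * (e - b) by ring.
have a1 : a ≼ 1.
  by rewrite -[a](subKr c); apply: domB (const_dom1 dc) (precW ca).
apply: precD.
  apply: dom_prec_trans ca.
  by have := domMl (c - a) (const_dom1 de); rewrite mulr1.
by apply: dom_prec_trans eb; have := domMr (e - b) a1; rewrite mul1r.
Qed.

Lemma combinationA a : a \in A -> combination a.
Proof. by move=> aA; rewrite -[a]mulr1; apply: combination_in near_const1. Qed.

Lemma combinationD p q : combination p -> combination q -> combination (p + q).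
Proof.
move=> [r [rP ->]] [s [sP ->]]; exists (r ++ s); split; last by rewrite big_cat.
by move=> x; rewrite mem_cat => /orP[/rP|/sP].
Qed.

Lemma combinationM p q : combination p -> combination q -> combination (p * q).
Proof.
move=> [r [rP ->]] [s [sP ->]].
exists [seq (x.1 * y.1, x.2 * y.2) | x <- r, y <- s]; split.
  move=> _ /allpairsP[[x y] /= [/rP[xA xn] /sP[yA yn] ->]] /=.
  by rewrite rpredM //; split=> //; apply: near_constM.
rewrite big_allpairs_dep mulr_suml; apply: eq_bigr => x _.
by rewrite mulr_sumr; apply: eq_bigr => y _ /=; rewrite mulrACA.
Qed.

Lemma combinationN p : combination p -> combination (- p).
Proof.
move=> pc; rewrite -mulN1r; apply: combinationM => //.
by apply: combinationA; rewrite rpredN rpred1.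
Qed.

Lemma combination_der p : combination p -> combination (vder p).
Proof.
move=> [r [rP ->]]; exists [seq (vder x.1, x.2) | x <- r]; split.
  by move=> _ /mapP[x /rP[xA xn] ->]; split=> //; apply: Ader.
rewrite der_sum big_map !big_seq; apply: eq_bigr => x /rP[_ [dx _]] /=.
by rewrite derM dx mulr0 addr0.
Qed.

(** Both elements are written over one concatenated list of constants, so one [d] serves all
    coefficients [s] and [t]. *)
Lemma combination_approx p q : combination p -> combination q ->
  exists2 d, small d & forall s t, s \in A -> t \in A -> approx d (s * p + t * q).
Proof.
move=> [r1 [r1P ->]] [r2 [r2P ->]]; pose r := r1 ++ r2.
pose x i := tnth (in_tuple r) i.
have xP i : (x i).1 \in A /\ near_const (x i).2.
  have : x i \in r by apply: mem_tnth.
  by rewrite mem_cat => /orP[/r1P|/r2P].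
have [d sd dP] := approx_combination (fun i => (xP i).2).
exists d => // s t sA tA.
(* The first block of the list, coming from [p], is scaled by [s], the second by [t]. *)
pose f (i : 'I_(size r)) := (if (i < size r1)%N then s else t) * (x i).1.
have fA i : f i \in A by rewrite rpredM ?(xP i).1 //; case: ifP.
suff -> : s * (\sum_(y <- r1) y.1 * y.2) + t * (\sum_(y <- r2) y.1 * y.2)
    = \sum_i f i * (x i).2 by exact: dP.
have -> : \sum_i f i * (x i).2 = \sum_(0 <= i < size r)
    (if (i < size r1)%N then s else t) * ((nth 0 r i).1 * (nth 0 r i).2).
  rewrite big_mkord; apply: eq_bigr => i _.
  by rewrite /f /x (tnth_nth 0) /= mulrA.
rewrite size_cat (big_cat_nat (n := size r1)) ?leq_addr //=; congr (_ + _).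
  rewrite (big_nth 0) mulr_sumr; apply: eq_big_nat => i /andP[_ ir].
  by rewrite ir nth_cat ir.
rewrite (big_nth 0) mulr_sumr -[RHS]/(\sum_(0 + size r1 <= i < _) _) big_addn addKn.
apply: eq_big_nat => i _; rewrite ltnNge leq_addl /= nth_cat ltnNge leq_addl /=.
by rewrite addnK.
Qed.

(** Since [p / q - t = (p - t * q) / q], it suffices to approximate numerator and denominator
    separately; [d] is chosen before [t], so every approximation [t] can be improved by the same
    factor. *)
Lemma fraction_approx x : fraction x ->
  exists2 d, small d & forall t, t \in A -> approx d (x - t).
Proof.
move=> [p [q [pc qc q0 ->]]]; have [d [dA d0 d1] dP] := combination_approx pc qc.
exists d => // t tA.
have [a aA pa] := dP 1 (- t) (rpred1 _) (etrans (rpredN _ _) tA).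
have [h hA qh] := dP 0 1 (rpred0 _) (rpred1 _).
rewrite mul0r mul1r add0r in qh; rewrite mul1r mulNr in pa.
have dom_d w : d * w ≼ w by have := domMr w (precW d1); rewrite mul1r.
have [hq qh'] : h ≍ q.
  apply: precB_asym; rewrite -opprB; apply/precN/(dom_prec_trans qh).
  by have := precMr q0 d1; rewrite mul1r.
have h0 : h != 0.
  by apply/eqP => e; move: qh' q0; rewrite e => /dom_le0 ->; rewrite eqxx.
have aw : a ≼ p - t * q.
  by rewrite -[a](subKr (p - t * q)); apply: domB (dom_refl _) (dom_trans pa _).
exists (a / h); first by rewrite rpred_div.
(* The first term carries the error of [a]; the second equals [a * (h^-1 - q^-1)] and carries the
   error of [h]. *)
have -> : p / q - t - a / h
    = (p - t * q - a) * q^-1 - a * (h^-1 * ((q - h) * q^-1)).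
  by field; rewrite q0 h0.
have -> : d * (p / q - t) = d * (p - t * q) * q^-1 by field.
apply: domB; first exact: domMr.
have -> : d * (p - t * q) * q^-1 = (p - t * q) * (q^-1 * d) by ring.
apply: domM => //; apply: domM; first exact: domV.
by have := domMr q^-1 qh; rewrite mulfK.
Qed.

(** * Ungroundedness, lambda-freeness and constants of the field of fractions *)

Lemma approx_asym d w : small d -> w != 0 -> approx d w ->
  exists2 a, a \in A & a != 0 /\ w ≍ a.
Proof.
move=> [_ d0 d1] w0 [a aA wa].
have [aw wa'] : a ≍ w.
  apply: precB_asym; rewrite -opprB; apply/precN/(dom_prec_trans wa).
  by have := precMr w0 d1; rewrite mul1r.
exists a => //; split=> //; apply/eqP => e; move: wa' w0.
by rewrite e => /dom_le0 ->; rewrite eqxx.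
Qed.

(** [x] is asymptotic to some [a] in [A], hence [dagger x ≍ dagger a], and ungroundedness of [A]
    applies to [a]. *)
Lemma fraction_ungrounded x : fraction x -> x != 0 -> ~ x ≍ 1 ->
  exists h, h != 0 /\ ~ h ≍ 1 /\ dagger h ≺ dagger x.
Proof.
move=> /fraction_approx[d sd /(_ 0 (rpred0 _))]; rewrite subr0 => xd x0 nx.
have [a aA [a0 [xa ax]]] := approx_asym sd x0 xd.
have na : ~ a ≍ 1.
  by move=> [a1 a1']; apply: nx; split; [apply: dom_trans a1 | apply: dom_trans ax].
have [h hA [h0 nh ha]] := Aungr aA a0 na; exists h; split=> //; split=> //.
apply: prec_dom_trans ha _.
exact: (precB_asym (dagger_asym Lpd x0 (conj xa ax) na)).2.
Qed.

(* Otherwise s - g†† ≺ g† for all g ≻ 1 in A. For g = d^-1, improving the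
   approximation g†† of s by the factor d gives t with s - t ≺ d g† ≍ d',
   whereas lambda-freeness at t bounds s - t from below by some h†, and
   d' ≺ h†. *)
Lemma fraction_lambda s : fraction s ->
  exists g, 1 ≺ g /\ dagger g ≼ s - dagger (dagger g).
Proof.
move=> /fraction_approx[d [dA d0 d1] dP]; apply: contrapT => none.
have sg g : 1 ≺ g -> s - dagger (dagger g) ≺ dagger g.
  by move=> g1; apply/precE => sg; apply: none; exists g.
have di1 : 1 ≺ d^-1.
  have di0 : d^-1 != 0 by rewrite invr_eq0.
  by have := precMr di0 d1; rewrite mulfV // mul1r.
have ddA : dagger (dagger d^-1) \in A.
  by apply: dagger_in; apply: dagger_in; rewrite rpredV.
have [a aA sa] := dP _ ddA.
set t := dagger (dagger d^-1) + a.
have [h hA [h1 ht]] := Alambda (rpredD ddA aA).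
have h0 := prec_neq0 h1.
have st : s - t ≺ vder d.
  rewrite opprD addrA; apply: dom_prec_trans sa _.
  have := precMl d0 (sg _ di1); rewrite daggerV // mulrN -der_dagger // => ds.
  by apply: prec_dom_trans ds (domN (dom_refl _)).
(* Otherwise subtracting [s - t] from [s - dagger (dagger h)] would give
   [t - dagger (dagger h) ≺ dagger h]. *)
have hst : dagger h ≼ s - t.
  apply: not_prec => /precN/(precD (sg _ h1))/precE[].
  by rewrite opprB addrC subrKA.
have nh : ~ h ≍ 1 by case=> /(prec_dom_trans h1)/prec_irr.
have /precE[] := der_prec_dagger Lpd (precW d1) h0 nh.
exact: dom_trans hst (precW st).
Qed.

(** [x] is infinitely close to some [a ≼ 1] in [A]. A constant of [L] infinitely close to [a] is a
    near constant, hence already a fraction. *)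
Lemma fraction_const x : d_valued L -> fraction x -> x ≼ 1 ->
  exists c, [/\ fraction c, vder c = 0 & x - c ≺ 1].
Proof.
move=> [_ Ldv] /fraction_approx[d [dA d0 d1] dP] x1.
have [a aA] := dP 0 (rpred0 _); rewrite subr0 => xa.
have xa1 : x - a ≺ 1.
  apply: dom_prec_trans xa _; apply: dom_prec_trans d1.
  by have := domMl d x1; rewrite mulr1.
have a1 : a ≼ 1.
  by rewrite -[a](subKr x); apply: domB x1 (precW xa1).
have [c [dc ac]] := Ldv a a1; exists c; split=> //.
  exists c, 1; split; rewrite ?oner_neq0 ?divr1 //; last first.
    exact/combinationA/rpred1.
  rewrite -[c]mul1r; apply: combination_in; first exact: rpred1.
  by split=> //; exists a => //; rewrite -opprB; apply: precN.
by rewrite -(subrKA a); apply: precD.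
Qed.

Lemma fractionA a : a \in A -> fraction a.
Proof.
move=> aA; exists a, 1; split; rewrite ?oner_neq0 ?divr1 //.
  exact: combinationA.
exact/combinationA/rpred1.
Qed.

Lemma fraction_der x : fraction x -> fraction (vder x).
Proof.
move=> [p [q [pc qc q0 ->]]].
exists (vder p * q + - (p * vder q)), (q * q); split.
- apply: combinationD; last apply: combinationN; apply: combinationM => //;
  exact: combination_der.
- exact: combinationM.
- by rewrite mulf_neq0.
by rewrite derM derV; field.
Qed.

Lemma fraction_divring_closed : divring_closed [pred x | `[< fraction x >]].
Proof.
split=> [|x y|x y]; rewrite ?inE.
- exact/asboolP/fractionA/rpred1.
- move=> /asboolP[p [q [pc qc q0 ->]]] /asboolP[r [s [rc sc s0 ->]]].
  apply/asboolP; exists (p * s + - (r * q)), (q * s); split.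
  + apply: combinationD; last apply: combinationN; exact: combinationM.
  + exact: combinationM.
  + by rewrite mulf_neq0.
  by field; rewrite q0 s0.
move=> /asboolP[p [q [pc qc q0 ->]]] /asboolP[r [s [rc sc s0 ->]]].
apply/asboolP; have [->|r0] := eqVneq r 0.
  by rewrite mul0r invr0 mulr0; apply/fractionA/rpred0.
exists (p * s), (q * r); split.
- exact: combinationM.
- exact: combinationM.
- by rewrite mulf_neq0.
by field; rewrite q0 s0 r0.
Qed.

End LambdaFreeSubfield.

(** * Differential subfields as valued differential fields *)

Section DifferentialSubfield.
Variables (L : VDF) (S : divringClosed L).
Hypothesis Sder : forall x, x \in S -> vder x \in S.

Record subfield : Type := Subfield { subfield_val : L; _ : subfield_val \in S }.
HB.instance Definition _ := [isSub for subfield_val].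
HB.instance Definition _ := [Choice of subfield by <:].
HB.instance Definition _ := [SubChoice_isSubComUnitRing of subfield by <:].
HB.instance Definition _ := [SubComUnitRing_isSubIntegralDomain of subfield by <:].
HB.instance Definition _ := [SubIntegralDomain_isSubField of subfield by <:].

Definition sub_der (x : subfield) : subfield := Subfield (Sder (valP x)).
Definition sub_dom (x y : subfield) : Prop := val x ≼ val y.

Lemma sub_der_ok : is_derivation sub_der.
Proof.
split=> x y; apply: val_inj; rewrite ?rmorphD ?rmorphM /=.
  by rewrite derD.
by rewrite derM.
Qed.

Lemma sub_dom_ok : is_dominance sub_dom.
Proof.
rewrite /sub_dom /is_dominance rmorph0 rmorph1.
split; first by case: (vdom_ok L).
split; first by move=> f; apply: dom_refl.
split; first by move=> f g h; apply: dom_trans.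
split; first by move=> f g; apply: dom_total.
split=> f g h; first by rewrite !rmorphM; apply: domMr.
by rewrite rmorphB; apply: domB.
Qed.

Definition sub_vdf : VDF :=
  {| vcar := subfield; vder := sub_der; vdom := sub_dom;
     vder_ok := sub_der_ok; vdom_ok := sub_dom_ok |}.

Definition sub_incl (x : sub_vdf) : L := val (x : subfield).

Lemma sub_incl_embedding : vdf_embedding sub_incl.
Proof.
split; first exact: val_inj.
split; first exact: rmorph1.
split; first by move=> x y; apply: rmorphD.
by split; first by move=> x y; apply: rmorphM.
Qed.

End DifferentialSubfield.

(** * Embeddings: preserved structure, images and inherited axioms *)

Section Embedding.
Variables (K L : VDF) (i : K -> L).
Hypothesis iE : vdf_embedding i.

Lemma emb_inj : injective i. Proof. by case: iE. Qed.
Lemma emb1 : i 1 = 1. Proof. by case: iE => _ []. Qed.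
Lemma embD x y : i (x + y) = i x + i y. Proof. by case: iE => _ [_ []]. Qed.
Lemma embM x y : i (x * y) = i x * i y. Proof. by case: iE => _ [_ [_ []]]. Qed.
Lemma emb_der x : i (vder x) = vder (i x). Proof. by case: iE => _ [_ [_ [_ []]]]. Qed.
Lemma emb_dom x y : x ≼ y <-> i x ≼ i y. Proof. by case: iE => _ [_ [_ [_ []]]]. Qed.

Lemma emb0 : i 0 = 0.
Proof. by apply: (addIr (i 0)); rewrite -embD !add0r. Qed.

Lemma embB x y : i (x - y) = i x - i y.
Proof. by apply/eqP; rewrite eq_sym subr_eq -embD subrK. Qed.

Lemma emb_eq0 x : (i x == 0) = (x == 0).
Proof. by rewrite -emb0 (inj_eq emb_inj). Qed.

Lemma embV x : i x^-1 = (i x)^-1.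
Proof.
have [->|x0] := eqVneq x 0; first by rewrite invr0 emb0 invr0.
have ix0 : i x != 0 by rewrite emb_eq0.
by apply: (mulfI ix0); rewrite -embM !mulfV // emb1.
Qed.

Lemma emb_dagger x : i (dagger x) = dagger (i x).
Proof. by rewrite /dagger embM embV emb_der. Qed.

Lemma emb_prec x y : x ≺ y <-> i x ≺ i y.
Proof. by rewrite /vprec !emb_dom. Qed.

Lemma emb_asym x y : x ≍ y <-> i x ≍ i y.
Proof. by rewrite /vasym !emb_dom. Qed.

(** Membership is decided classically, since [divringClosed] packs a boolean predicate. *)
Definition image_pred : pred L := fun y => `[< exists x, y = i x >].

Lemma image_divring_closed : divring_closed image_pred.
Proof.
split=> [|_ _ /asboolP[x ->] /asboolP[y ->]|_ _ /asboolP[x ->] /asboolP[y ->]].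
- by apply/asboolP; exists 1; rewrite emb1.
- by apply/asboolP; exists (x - y); rewrite embB.
- by apply/asboolP; exists (x / y); rewrite embM embV.
Qed.

Lemma emb_H_asymptotic : H_asymptotic L -> H_asymptotic K.
Proof.
move=> [La LH]; split=> [f g f0 g0|f g f0] /emb_prec fx /emb_prec gx.
  rewrite emb1 in fx gx; rewrite !emb_prec !emb_der.
  by apply: La; rewrite ?emb_eq0.
rewrite emb1 in gx; apply/emb_dom; rewrite !emb_dagger.
by apply: LH; rewrite ?emb_eq0.
Qed.

Lemma emb_pre_d_valued : pre_d_valued L -> pre_d_valued K.
Proof.
move=> Lpd f g /emb_dom f1 g0 /emb_prec g1; rewrite emb1 in f1 g1.
by apply/emb_prec; rewrite emb_dagger emb_der; apply: Lpd; rewrite ?emb_eq0.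
Qed.

End Embedding.

(** * Identifying the hull with the field of fractions *)

Theorem theorem10p2 (K : VDF) :
  pre_d_valued K -> H_asymptotic K -> lambda_free K ->
  forall (L : VDF) (e : K -> L), is_dv_hull e -> lambda_free L.
Proof.
move=> _ _ [_ Kungr [k0 [k00 k01]] Kl] L e [Ldv LH eE univ].
have Lpd := Ldv.1.
pose A : divringClosed L := HB.pack (image_pred e)
  (GRing.isDivringClosed.Build L (image_pred e) (image_divring_closed eE)).
have eA x : e x \in A by apply/asboolP; exists x.
have Ader x : x \in A -> vder x \in A.
  by move=> /asboolP[y ->]; rewrite -(emb_der eE).
have Ant : exists2 g, g \in A & g != 0 /\ g ≺ 1.
  by exists (e k0) => //; rewrite (emb_eq0 eE) -(emb1 eE) -(emb_prec eE).
have Aungr g : g \in A -> g != 0 -> ~ g ≍ 1 ->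
    exists2 h, h \in A & [/\ h != 0, ~ h ≍ 1 & dagger h ≺ dagger g].
  move=> /asboolP[x ->]; rewrite (emb_eq0 eE) -(emb1 eE) -(emb_asym eE) => x0 nx.
  have [h [h0 [nh hx]]] := Kungr x x0 nx; exists (e h) => //.
  rewrite (emb_eq0 eE) -!(emb_dagger eE).
  by split; [ | move/(emb_asym eE) | apply/(emb_prec eE)].
have Al s : s \in A ->
    exists2 g, g \in A & 1 ≺ g /\ dagger g ≼ s - dagger (dagger g).
  move=> /asboolP[x ->]; have [g [g1 gx]] := Kl x; exists (e g) => //.
  by rewrite -(emb1 eE) -!(emb_dagger eE) -(embB eE) -(emb_prec eE) -(emb_dom eE).
have Scl := @fraction_divring_closed L A Lpd.
pose P : pred L := fun x => `[< fraction A x >].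
pose S : divringClosed L := HB.pack P (GRing.isDivringClosed.Build L P Scl).
have Sder x : x \in S -> vder x \in S.
  by move=> /asboolP xS; apply/asboolP/fraction_der.
pose M := sub_vdf Sder.
have MI := sub_incl_embedding Sder.
have Mdv : d_valued M.
  split=> [|x x1]; first exact: emb_pre_d_valued MI Lpd.
  have /asboolP xS := valP (x : subfield S).
  have [|c [/asboolP cS dc xc]] := fraction_const Lpd LH Ader Ant Aungr Al Ldv xS.
    by rewrite -(emb1 MI); apply/(emb_dom MI).
  exists (Subfield (S := S) cS); split; first exact: val_inj.
  by apply/(emb_prec MI); rewrite (emb1 MI) (embB MI).
have ES x : e x \in S by apply/asboolP; apply: fractionA.
pose e' (x : K) : M := Subfield (ES x).
have e'E : vdf_embedding e'.
  split; first by move=> x y /(congr1 (@sub_incl _ _ Sder)) /(emb_inj eE).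
  split; first by apply/val_inj; apply: emb1 eE.
  split; first by move=> x y; apply/val_inj; apply: embD eE x y.
  split; first by move=> x y; apply/val_inj; apply: embM eE x y.
  by split; [move=> x; apply/val_inj; apply: emb_der eE x | apply: emb_dom eE].
(* [M] is the field of fractions inside [L]; it is d-valued of H-type and contains the image of [K],
   so the hull maps into it. *)
have [[j [jE je]] _] := univ M e' Mdv (emb_H_asymptotic MI LH) e'E.
have LS y : fraction A y.
  have idE : vdf_embedding (@id L) by do ![split=> //].
  (* This composite and the identity are two embeddings of [L] into itself extending [e]. By
     uniqueness they agree, so every [y] lies in [S]. *)
  have jiE : vdf_embedding (@sub_incl _ _ Sder \o j).
    split; first exact: inj_comp (emb_inj MI) (emb_inj jE).
    split; first by rewrite /= (emb1 jE) (emb1 MI).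
    split; first by move=> x z; rewrite /= (embD jE) (embD MI).
    split; first by move=> x z; rewrite /= (embM jE) (embM MI).
    split; first by move=> x; rewrite /= (emb_der jE) (emb_der MI).
    by move=> x z; rewrite (emb_dom jE) (emb_dom MI).
  have [_ uniq] := univ L e Ldv LH eE.
  have <- : sub_incl (j y) = y.
    by apply: (uniq _ _ jiE idE) => // x; rewrite /= je.
  by have /asboolP := valP (j y : subfield S).
split=> //.
- move=> g g0 ng; exact (fraction_ungrounded Lpd LH Ader Ant Aungr Al (LS g) g0 ng).
- by have [g _ gP] := Ant; exists g.
by move=> s; exact (fraction_lambda Lpd LH Ader Ant Aungr Al (LS s)).
Qed.
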